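(* Let $R$ be a commutative ring with identity. If $R$ admits a positively expansive automorphism, then $R$ has finitely many maximal ideals.
   Context: A generator of $R$ is a finite set $\mathcal I$ of ideals of $R$ with $\sum_{I\in\mathcal I}I=R$. The product of generators is $\mathcal I\mathcal J=\{IJ\mid I\in\mathcal I,\,J\in\mathcal J\}$, and similarly for finitely many factors. For families of sets, $\mathcal A\prec\mathcal B$ means that for every $A\in\mathcal A$ there is $B\in\mathcal B$ with $A\subseteq B$. For a ring automorphism $\alpha\colon R\to R$ and $i\in\mathbb Z$, $\alpha^{i}(\mathcal I)=\{\alpha^{i}(I)\mid I\in\mathcal I\}$. An automorphism $\alpha\colon R\to R$ is positively expansive if there is a generator $\mathcal I$ such that for every generator $\mathcal J$ there is $N\ge 0$ with $\prod_{i=0}^N\alpha^{-i}(\mathcal I)\prec\mathcal J$. *)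

(* Defs.v *)
From HB Require Import structures.
From mathcomp Require Import all_boot all_order all_algebra.
From mathcomp Require Import boolp classical_sets functions cardinality.

Set Implicit Arguments.
Unset Strict Implicit.
Unset Printing Implicit Defensive.

Import GRing.Theory.

Local Open Scope classical_set_scope.
Local Open Scope ring_scope.

(* MathComp's [idealr_closed] demands [1 \notin I], which would exclude the
   unit ideal from generators; hence a separate notion of ideal. The base
   [comPzRingType] includes the zero ring. *)
Definition is_ideal (R : comPzRingType) (I : set R) : Prop :=
  [/\ I 0,
      forall x y, I x -> I y -> I (x + y)
    & forall a x, I x -> I (a * x)].

Definition maximal_ideal (R : comPzRingType) (M : set R) : Prop :=
  [/\ is_ideal M, M <> setT
    & forall J : set R, is_ideal J -> M `<=` J -> J = M \/ J = setT].

(* The sum of the empty family is the zero ideal (take [n = 0]). *)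
Definition ideal_sum (R : comPzRingType) (F : set (set R)) : set R :=
  [set x | exists (n : nat) (f : 'I_n -> R),
     (forall i, exists2 I, F I & I (f i)) /\ x = \sum_(i < n) f i].

Definition ideal_mul (R : comPzRingType) (I J : set R) : set R :=
  [set x | exists (n : nat) (f g : 'I_n -> R),
     [/\ forall i, I (f i), forall i, J (g i) & x = \sum_(i < n) f i * g i]].

Definition generator (R : comPzRingType) (F : set (set R)) : Prop :=
  [/\ finite_set F, forall I, F I -> is_ideal I & ideal_sum F = setT].

Definition gen_mul (R : comPzRingType) (F G : set (set R)) : set (set R) :=
  [set ideal_mul I J | I in F & J in G].

(* [gen_prod F N] is the product of the [N + 1] families F 0, ..., F N. *)
Fixpoint gen_prod (R : comPzRingType) (F : nat -> set (set R)) (N : nat) :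
    set (set R) :=
  if N is n.+1 then gen_mul (gen_prod F n) (F n.+1) else F 0%N.

Definition refines (T : Type) (A B : set (set T)) : Prop :=
  forall X, A X -> exists2 Y, B Y & X `<=` Y.

Record ring_aut (R : comPzRingType) := RingAut {
  aut_fun :> {rmorphism R -> R};
  aut_inv : R -> R;
  aut_funK : cancel aut_fun aut_inv;
  aut_invK : cancel aut_inv aut_fun }.

Definition aut_pow (R : comPzRingType) (alpha : ring_aut R) (i : int) : R -> R :=
  match i with
  | Posz n => iter n alpha
  | Negz n => iter n.+1 (aut_inv alpha)
  end.

Definition aut_gen (R : comPzRingType) (alpha : ring_aut R) (i : int)
    (F : set (set R)) : set (set R) :=
  [set aut_pow alpha i @` I | I in F].

Definition positively_expansive (R : comPzRingType) (alpha : ring_aut R) : Prop :=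
  exists2 F : set (set R), generator F &
    forall G : set (set R), generator G ->
      exists N : nat, refines (gen_prod (fun i => aut_gen alpha (- i%:Z) F) N) G.

(* Main.v *)
Require Import Defs.
From mathcomp Require Import all_boot all_order all_algebra.
From mathcomp Require Import boolp classical_sets functions cardinality.

(** Say that a prime M has itinerary w if, for each i, the i-th translate of
    the ideal of F named by w i is not contained in M.
    Refining the generator alpha(F) by a product of length N + 1 means that
    the first N + 1 letters of the itinerary of M determine a letter for the
    preceding step, hence, inductively, letters for all the past.  So primes fall
    into finitely many classes, one for each word of length N + 1, such that
    for every K the K-th backward translates of primes of one class share an
    itinerary of length K.  Distinct maximal ideals M, M' share no long itinerary
    because {M, M'} is a generator; the number of maximal ideals is thus at
    most the number of words. *)

Local Open Scope classical_set_scope.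

Set Implicit Arguments.
Unset Strict Implicit.

Import GRing.Theory.
Local Open Scope ring_scope.

(** * Prime and maximal ideals *)

Definition prime_ideal (R : comPzRingType) (P : set R) : Prop :=
  [/\ is_ideal P, ~ P 1 & forall a b, P (a * b) -> P a \/ P b].

Lemma maximal_ideal_comaximal (R : comPzRingType) (M I : set R) :
  maximal_ideal M -> is_ideal I -> ~ I `<=` M ->
  exists2 a, M a & exists2 b, I b & a + b = 1.
Proof.
move=> [[M0 MD MM] _ Mmax] [I0 ID IM] IsubM.
pose J := [set z : R | exists2 a, M a & exists2 b, I b & a + b = z].
have Jideal : is_ideal J.
  split.
  - by exists 0 => //; exists 0 => //; rewrite addr0.
  - move=> _ _ [a Ma [b Ib <-]] [c Mc [d Id <-]].
    by exists (a + c); [exact: MD | exists (b + d); [exact: ID | rewrite addrACA]].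
  - move=> r _ [a Ma [b Ib <-]].
    by exists (r * a); [exact: MM | exists (r * b); [exact: IM | rewrite mulrDr]].
have MJ : M `<=` J by move=> a Ma; exists a => //; exists 0 => //; rewrite addr0.
have [JM|JT] := Mmax J Jideal MJ.
  by case: IsubM => b Ib; rewrite -JM; exists 0 => //; exists b => //; rewrite add0r.
by have : J 1 by rewrite JT.
Qed.

Lemma maximal_ideal_prime (R : comPzRingType) (M : set R) :
  maximal_ideal M -> prime_ideal M.
Proof.
move=> Mmax; have [Mideal MneT _] := Mmax; have [M0 MD MM] := Mideal.
split => // [M1|a b Mab].
  by apply: MneT; apply/seteqP; split => // x _; rewrite -[x]mulr1; exact: MM.
have [Ma|nMa] := pselect (M a); first by left.
right; pose aR := [set z : R | exists r, z = r * a].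
have aRideal : is_ideal aR.
  split; first by exists 0; rewrite mul0r.
    by move=> _ _ [r ->] [s ->]; exists (r + s); rewrite mulrDl.
  by move=> s _ [r ->]; exists (s * r); rewrite mulrA.
have aRsub : ~ aR `<=` M by move=> sub; apply/nMa/sub; exists 1; rewrite mul1r.
have [m Mm [_ [r ->] m1]] := maximal_ideal_comaximal Mmax aRideal aRsub.
rewrite -[b]mul1r -m1 mulrDl; apply: MD; first by rewrite mulrC; exact: MM.
by rewrite -mulrA; exact: MM.
Qed.

Lemma prime_ideal_preimage (R : comPzRingType) (f : {rmorphism R -> R})
    (P : set R) :
  prime_ideal P -> prime_ideal (f @^-1` P).
Proof.
move=> [[P0 PD PM] P1 Pprime]; split; first split.
- by rewrite /= rmorph0.
- by move=> x y /= Px Py; rewrite rmorphD; exact: PD.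
- by move=> a x /= Px; rewrite rmorphM; exact: PM.
- by rewrite /= rmorph1.
- by move=> a b /=; rewrite rmorphM; exact: Pprime.
Qed.

(** * Generators *)

Lemma ideal_sum_mem {R : comPzRingType} (P : set R) n (f : 'I_n -> R) :
  is_ideal P -> (forall i, P (f i)) -> P (\sum_(i < n) f i).
Proof. by case=> P0 PD _ Pf; elim/big_ind: _. Qed.

(** Otherwise the sum of the family, which contains 1, would lie in [P]. This supplies the letters
    of itineraries. *)
Lemma generator_avoids_prime (R : comPzRingType) (F : set (set R)) (P : set R) :
  generator F -> prime_ideal P -> exists2 I, F I & exists2 a, I a & ~ P a.
Proof.
move=> [_ _ Fsum] [Pideal P1 _]; apply: contrapT => noI; apply: P1.
have : ideal_sum F 1 by rewrite Fsum.
case=> n [f [Ff ->]]; apply: ideal_sum_mem => // i.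
have [I FI Ifi] := Ff i; apply: contrapT => nPfi.
by apply: noI; exists I => //; exists (f i).
Qed.

Lemma generator_maximal_pair (R : comPzRingType) (M M' : set R) :
  maximal_ideal M -> maximal_ideal M' -> M <> M' ->
  generator [set M; M'].
Proof.
move=> Mmax M'max neq; have [Mi MT _] := Mmax; have [M'i _ M'm] := M'max.
split; first exact: finite_set2.
  by move=> I [->|->].
have [|a Ma [b M'b ab1]] := maximal_ideal_comaximal Mmax M'i.
  by move=> sub; have [eqM|eqT] := M'm M Mi sub; [exact: neq | exact: MT].
have [_ _ MM] := Mi; have [_ _ M'M] := M'i.
apply/seteqP; split => // x _.
(* With [a + b = 1], split [x] as [x * a + x * b]. *)
exists 2%N, (fun i : 'I_2 => if i == ord0 then x * a else x * b); split.
  move=> i; case: ifP => _; first by exists M; [left | exact: MM].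
  by exists M'; [right | exact: M'M].
by rewrite big_ord_recl big_ord1 /= -mulrDr ab1 mulr1.
Qed.

Lemma generator_aut1 (R : comPzRingType) (alpha : ring_aut R) (F : set (set R)) :
  generator F -> generator (aut_gen alpha 1 F).
Proof.
move=> [Ffin Fideal Fsum]; split; first exact: finite_image.
  move=> _ [I FI <-]; have [I0 ID IM] := Fideal I FI; split.
  - by exists 0 => //=; rewrite rmorph0.
  - move=> _ _ [x Ix <-] [y Iy <-] /=.
    by exists (x + y); [exact: ID | rewrite /= rmorphD].
  - move=> a _ [x Ix <-]; exists (aut_inv alpha a * x); first exact: IM.
    by rewrite /= rmorphM aut_invK.
apply/seteqP; split => // y _.
have : ideal_sum F (aut_inv alpha y) by rewrite Fsum.
case=> n [f [Ff yE]]; exists n, (fun i => alpha (f i)); split.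
  move=> i; have [I FI Ifi] := Ff i.
  by exists (alpha @` I); [exists I | exists (f i)].
by rewrite -[LHS](aut_invK alpha) yE rmorph_sum.
Qed.

(** * Translates of primes under the automorphism *)

Lemma aut_powN (R : comPzRingType) (alpha : ring_aut R) (i : nat) :
  aut_pow alpha (- i%:Z) = iter i (aut_inv alpha).
Proof. by case: i. Qed.

(** [aut_inv] is a bare function, so its compatibility with the ring operations is first pulled back
    through the injective [alpha]. *)
Lemma aut_inv_iter_morph (R : comPzRingType) (alpha : ring_aut R) (i : nat)
    (P : set R) :
  prime_ideal P -> prime_ideal (iter i (aut_inv alpha) @^-1` P).
Proof.
pose beta := aut_inv alpha.
have inj : injective alpha := can_inj (aut_funK alpha).
move=> Pprime; elim: i P Pprime => [//|i IH] P [[P0 PD PM] P1 Pprime].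
suff : prime_ideal (beta @^-1` P) by exact: IH.
have beta0 : beta 0 = 0 by apply: inj; rewrite aut_invK rmorph0.
have beta1 : beta 1 = 1 by apply: inj; rewrite aut_invK rmorph1.
have betaD x y : beta (x + y) = beta x + beta y.
  by apply: inj; rewrite rmorphD !aut_invK.
have betaM x y : beta (x * y) = beta x * beta y.
  by apply: inj; rewrite rmorphM !aut_invK.
split; first split.
- by rewrite /= beta0.
- by move=> x y /= Px Py; rewrite betaD; exact: PD.
- by move=> a x /= Px; rewrite betaM; exact: PM.
- by rewrite /= beta1.
- by move=> a b /=; rewrite betaM; exact: Pprime.
Qed.

Lemma iter_aut_prime (R : comPzRingType) (alpha : ring_aut R) (k : nat)
    (P : set R) :
  prime_ideal P -> prime_ideal (iter k alpha @^-1` P).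
Proof.
move=> Pprime; elim: k P Pprime => [//|k IH] P Pprime.
exact: IH (prime_ideal_preimage _ Pprime).
Qed.

(** A relation, not a function of [P]: several ideals may escape [P] at the same step. Only the
    [n + 1] letters [w 0], ..., [w n] are constrained. *)
Definition itinerary {R : comPzRingType} (alpha : ring_aut R) {T : Type}
    (phi : T -> set R) (n : nat) (w : nat -> T) (P : set R) : Prop :=
  forall i, (i <= n)%N ->
    exists2 a, phi (w i) a & ~ P (iter i (aut_inv alpha) a).

(** * Itineraries, products of generators, and the past *)

Section Itineraries.
Context (R : comPzRingType) (alpha : ring_aut R) (T : Type) (phi : T -> set R).

Let F := range phi.
Let prods := gen_prod (fun i => aut_gen alpha (- i%:Z) F).

Lemma itinerary_leq m n w P :
  (m <= n)%N -> itinerary alpha phi n w P -> itinerary alpha phi m w P.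
Proof. by move=> mn wP i im; apply: wP; exact: leq_trans mn. Qed.

(** Multiply the translates of the ideals named by [w]: by primality, a product of elements outside
    [P] stays outside [P]. The ideal [X] depends on [w] alone, so it serves all primes with this
    itinerary at once. *)
Lemma itinerary_prod n w :
  exists2 X, prods n X & forall P, prime_ideal P ->
    itinerary alpha phi n w P -> exists2 a, X a & ~ P a.
Proof.
have Fw i : aut_gen alpha (- i%:Z) F (iter i (aut_inv alpha) @` phi (w i)).
  by rewrite -aut_powN; exists (phi (w i)) => //; exists (w i).
elim: n => [|n [X prodX XP]].
  exists (iter 0 (aut_inv alpha) @` phi (w 0%N)); first exact: Fw 0%N.
  by move=> P _ /(_ 0%N isT) [a wa nPa]; exists a => //; exists a.
exists (ideal_mul X (iter n.+1 (aut_inv alpha) @` phi (w n.+1))).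
  by exists X => //; exists (iter n.+1 (aut_inv alpha) @` phi (w n.+1)).
move=> P Pprime wP; have [_ _ Pmul] := Pprime.
have [a Xa nPa] := XP P Pprime (itinerary_leq (leqnSn n) wP).
have [b wb nPb] := wP n.+1 (leqnn _).
exists (a * iter n.+1 (aut_inv alpha) b); last by case/Pmul.
exists 1%N, (fun=> a), (fun=> iter n.+1 (aut_inv alpha) b).
by split; [ | move=> _; exists b | rewrite big_ord1].
Qed.

Lemma itinerary_refines n G w : refines (prods n) G ->
  exists2 Y, G Y & forall P, prime_ideal P ->
    itinerary alpha phi n w P -> exists2 a, Y a & ~ P a.
Proof.
move=> ref; have [X prodX XP] := itinerary_prod n w.
have [Y GY XY] := ref X prodX; exists Y => // P Pprime wP.
by have [a /XY Ya nPa] := XP P Pprime wP; exists a.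
Qed.

Lemma itinerary_exists P : generator F -> prime_ideal P ->
  exists w, forall n, itinerary alpha phi n w P.
Proof.
move=> genF Pprime.
have letter i : exists t, exists2 a, phi t a & ~ P (iter i (aut_inv alpha) a).
  have [_ [t _ <-] ta] :=
    generator_avoids_prime genF (aut_inv_iter_morph alpha i Pprime).
  by exists t.
by have [w wP] := choice letter; exists w => n i _; exact: wP.
Qed.

(** Refinement yields a letter [t] such that [alpha (phi t)] escapes the [k]-th backward translate
    of every [P] in the class; hence [phi t] escapes the next one. *)
Lemma itinerary_past N k w : refines (prods N) (aut_gen alpha 1 F) ->
  exists v, forall P, prime_ideal P -> itinerary alpha phi N w P ->
    itinerary alpha phi (N + k) v (iter k alpha @^-1` P).
Proof.
move=> ref; elim: k => [|k [v vP]]; first by exists w => P _; rewrite addn0.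
have [_ [_ [t _ <-] <-] tP] := itinerary_refines v ref.
(* The old letters move up by one place, since the extra [alpha] cancels one [aut_inv]. *)
exists (fun i => if i is j.+1 then v j else t) => P Pprime /(vP P Pprime) {}vP.
rewrite addnS => -[_|i] /=.
  have [_ [a ta <-] nPa] := tP _ (iter_aut_prime alpha k Pprime)
    (itinerary_leq (leq_addr k N) vP).
  by exists a => //=; rewrite -iterS iterSr.
rewrite ltnS => /vP [a va nPa]; exists a => //=.
by rewrite -iterS iterSr aut_invK.
Qed.

End Itineraries.

Unset Implicit Arguments.

(** * Counting maximal ideals by words *)

Theorem theorem3p4 (R : comPzRingType) :
  (exists alpha : ring_aut R, positively_expansive alpha) ->
  finite_set [set M : set R | maximal_ideal M].
Proof.
case=> alpha [F genF Fexp].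
have [p [phi Fphi]] : exists p (phi : 'I_p -> set R), F = range phi.
  have [Ffin _ _] := genF; have [s ->] := (finite_seqP _).1 Ffin.
  exists (size s), (tnth (in_tuple s)); apply/seteqP; split => [I|_ [i _ <-]].
    by move=> /(tnthP (in_tuple s))[i ->]; exists i.
  exact: mem_tnth.
subst F; have [N past] := Fexp _ (generator_aut1 alpha genF).
apply: contrapT => /infiniteP /pcard_leP [e].
have emax i : maximal_ideal (e i) by exact: (@funS _ _ _ _ e).
have einj : injective e by apply: in2TT; exact: inj.
pose m := #|{ffun 'I_N.+1 -> 'I_p}|.
have [k ke] : exists k : nat -> nat -> nat, forall i j, i <> j ->
    refines (gen_prod (fun i => aut_gen alpha (- i%:Z) (range phi)) (k i j))
      [set (e i : set R); (e j : set R)].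
  have sep (ij : nat * nat) : exists n, ij.1 <> ij.2 ->
      refines (gen_prod (fun i => aut_gen alpha (- i%:Z) (range phi)) n)
        [set (e ij.1 : set R); (e ij.2 : set R)].
    (* On the diagonal the claim is vacuous and 0 is a dummy value. *)
    have [eqij|neqij] := pselect (ij.1 = ij.2); first by exists 0%N.
    have genij : generator [set (e ij.1 : set R); (e ij.2 : set R)].
      by apply: generator_maximal_pair => // /einj.
    by have [n refn] := Fexp _ genij; exists n.
  by have [k kP] := choice sep; exists (fun i j => k (i, j)) => i j; exact: kP (i, j).
(* A bound good for every pair among [m + 1] of the ideals, because the pair that the pigeonhole
   principle returns is not yet known. *)
pose K := \max_(i < m.+1) \max_(j < m.+1) k i j.
have kK (i j : 'I_m.+1) : (k i j <= K)%N.
  apply: leq_trans (leq_bigmax i).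
  exact: (leq_bigmax (F := fun j : 'I_m.+1 => k i j) j).
(* This is the image of [e i] under the [K]-th power of [alpha]; its past [K] steps back is the
   itinerary of [e i]. *)
pose x i : set R := iter K (aut_inv alpha) @^-1` e i.
have xprime i : prime_ideal (x i).
  by apply: aut_inv_iter_morph; exact: maximal_ideal_prime.
have [w wx] := choice (fun i => itinerary_exists alpha genF (xprime i)).
pose c (i : 'I_m.+1) := [ffun t : 'I_N.+1 => w i t].
have [i [j [neqij eqc]]] : exists i j, i <> j /\ c i = c j.
  apply: contrapT => noij.
  have cinj : injective c.
    by move=> i j eqc; apply: contrapT => neq; apply: noij; exists i, j.
  by have := leq_card c cinj; rewrite card_ord ltnn.
(* The words [w i] and [w j] may differ after place [N], but [itinerary_past] reads only the first
   [N + 1] letters. *)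
have wxj : itinerary alpha phi N (w i) (x j).
  move=> t tN; have := congr1 (fun f : {ffun 'I_N.+1 -> 'I_p} => f (inord t)) eqc.
  by rewrite !ffunE inordK // => ->; exact: (wx j N).
have [v vP] := itinerary_past K (w i) past.
have back l : iter K alpha @^-1` x l = e l.
  apply/funext => a; rewrite /x /=; congr (_ _).
  by elim: (K) => // n IH; rewrite iterSr iterS aut_funK.
have kNK : (k i j <= N + K)%N by apply: leq_trans (kK i j) (leq_addl _ _).
have vi := itinerary_leq kNK (vP _ (xprime i) (wx i N)).
have vj := itinerary_leq kNK (vP _ (xprime j) wxj).
rewrite !back in vi vj.
have neq : (i : nat) <> j by move=> /ord_inj.
(* [Y] is [e i] or [e j], yet it is contained in neither. *)
have [Y eY YP] := itinerary_refines v (ke i j neq).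
have [a Ya nai] := YP _ (maximal_ideal_prime (emax i)) vi.
have [b Yb nbj] := YP _ (maximal_ideal_prime (emax j)) vj.
by case: eY => eY; rewrite eY in Ya Yb.
Qed.
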